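(* For every $n\ge2$, the depth triangles (or equivalently the catalan triangles) of order $n$ are in bijection with the bicolored pipe dreams with $n-2$ pipes.
   Context: $\mathcal{D}_n$ is the set of triples $(y_1,y_2,y_3)\in\mathbb{N}^3$ with $y_1+y_2+y_3=n-2$. A depth triangle of order $n$ is a map $\delta:\mathcal{D}_n\to\mathbb{Z}$ such that $\delta(i,0,n-2-i)=0$ for all $0\le i\le n-2$, and $|\delta(y_1,y_2,y_3)-\delta(y_1,y_2-1,y_3+1)|=1=|\delta(y_1,y_2,y_3)-\delta(y_1+1,y_2-1,y_3)|$ for all $(y_1,y_2,y_3)\in\mathcal{D}_n$ with $y_2\ge1$. A catalan triangle of order $n$ is a map $\gamma:\mathcal{D}_n\to\mathbb{N}$ such that $\gamma(i,0,n-2-i)=i+1$ for all $0\le i\le n-2$ and, for all $(y_1,y_2,y_3)\in\mathcal{D}_n$ with $y_2\ge1$, $\gamma(y_1,y_2-1,y_3+1)\le\gamma(y_1,y_2,y_3)\le\gamma(y_1+1,y_2-1,y_3)$, $\ \gamma(y_1,y_2,y_3)-\gamma(y_1,y_2-1,y_3+1)\le1$ and $\gamma(y_1+1,y_2-1,y_3)-\gamma(y_1,y_2,y_3)\le1$. A pipe dream with $m$ pipes is a filling of the triangular (staircase) shape with cells $(r,c)$, $r,c\ge1$, $r+c\le m$ ($r$ the row from the top, $c$ the column from the left), where each cell is either a crossing (joining its west side to its east side and its south side to its north side) or a contact (joining its west side to its north side and its south side to its east side); moreover the boundary cells with $r+c=m+1$ each contain a single elbow joining the west side to the north side. This yields $m$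 pipes, each entering on the left side and exiting on the top side. Pipes may cross several times. A bicolored pipe dream is a pipe dream together with a coloring of each pipe in red or blue such that at each contact in a cell with $r+c\le m$ the two pipes in contact have distinct colors (no condition at crossings). *)

(* Defs.v *)
From HB Require Import structures.
From mathcomp Require Import all_boot all_order all_algebra.

Set Implicit Arguments.
Unset Strict Implicit.
Unset Printing Implicit Defensive.

Import GRing.Theory Num.Theory.

(* The bound n.-1 on each coordinate is implied by the sum when 2 <= n; it only
   makes the type finite. *)
Definition triple n :=
  {y : 'I_n.-1 * 'I_n.-1 * 'I_n.-1 | y.1.1 + y.1.2 + y.2 == n - 2}.

Definition y1 n (y : triple n) : nat := (val y).1.1.
Definition y2 n (y : triple n) : nat := (val y).1.2.
Definition y3 n (y : triple n) : nat := (val y).2.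

(* z = (y1, y2 - 1, y3 + 1); such a z exists iff y2 >= 1. *)
Definition nextl n (y z : triple n) :=
  [&& y1 z == y1 y, (y2 z).+1 == y2 y & y3 z == (y3 y).+1].

(* z = (y1 + 1, y2 - 1, y3). *)
Definition nextr n (y z : triple n) :=
  [&& y1 z == (y1 y).+1, (y2 z).+1 == y2 y & y3 z == y3 y].

Definition is_depth_triangle n (delta : {ffun triple n -> int}) : bool :=
  [&& [forall y, (y2 y == 0) ==> (delta y == 0%R)],
      [forall y, forall z, nextl y z ==> (`|delta y - delta z| == 1)%R]
    & [forall y, forall z, nextr y z ==> (`|delta y - delta z| == 1)%R]].

Definition depth_triangle n :=
  {delta : {ffun triple n -> int} | is_depth_triangle delta}.

(* The truncated subtractions are exact, thanks to the preceding inequality. *)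
Definition is_catalan_triangle n (gamma : {ffun triple n -> nat}) : bool :=
  [&& [forall y, (y2 y == 0) ==> (gamma y == (y1 y).+1)],
      [forall y, forall z, nextl y z ==>
         (gamma z <= gamma y) && (gamma y - gamma z <= 1)]
    & [forall y, forall z, nextr y z ==>
         (gamma y <= gamma z) && (gamma z - gamma y <= 1)]].

Definition catalan_triangle n :=
  {gamma : {ffun triple n -> nat} | is_catalan_triangle gamma}.

Variant side := West | South | East | North.

Definition nat_of_side s :=
  match s with West => 0 | South => 1 | East => 2 | North => 3 end.
Definition side_of_nat k :=
  match k with 0 => West | 1 => South | 2 => East | _ => North end.
Lemma nat_of_sideK : cancel nat_of_side side_of_nat. Proof. by case. Qed.
HB.instance Definition _ := Countable.copy side (can_type nat_of_sideK).
Lemma side_enumP : Finite.axiom [:: West; South; East; North].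
Proof. by case. Qed.
HB.instance Definition _ := isFinite.Build side side_enumP.

Variant tile := Crossing | Contact | Elbow.

Definition nat_of_tile t :=
  match t with Crossing => 0 | Contact => 1 | Elbow => 2 end.
Definition tile_of_nat k :=
  match k with 0 => Crossing | 1 => Contact | _ => Elbow end.
Lemma nat_of_tileK : cancel nat_of_tile tile_of_nat. Proof. by case. Qed.
HB.instance Definition _ := Countable.copy tile (can_type nat_of_tileK).
Lemma tile_enumP : Finite.axiom [:: Crossing; Contact; Elbow].
Proof. by case. Qed.
HB.instance Definition _ := isFinite.Build tile tile_enumP.

Variant color := Red | Blue.

Definition is_red k := if k is Red then true else false.
Definition color_of_bool (b : bool) := if b then Red else Blue.
Lemma is_redK : cancel is_red color_of_bool. Proof. by case. Qed.
HB.instance Definition _ := Countable.copy color (can_type is_redK).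
Lemma color_enumP : Finite.axiom [:: Red; Blue]. Proof. by case. Qed.
HB.instance Definition _ := isFinite.Build color color_enumP.

(* Cells (r, c), counted from 1, including the boundary cells r + c = m + 1. *)
Definition cell m :=
  {x : 'I_m.+1 * 'I_m.+1 | [&& 0 < x.1, 0 < x.2 & x.1 + x.2 <= m.+1]}.

Definition row m (x : cell m) : nat := (val x).1.
Definition col m (x : cell m) : nat := (val x).2.

Definition pipe_dream m :=
  {t : {ffun cell m -> tile} |
     [forall x, (t x == Elbow) == (row x + col x == m.+1)]}.

Definition tile_at m (P : pipe_dream m) (x : cell m) : tile := val P x.

(* The strands of a tile, oriented away from the left border: a pipe enters a
   cell from the west or the south and leaves it to the east or the north. *)
Definition strand (t : tile) (s s' : side) : bool :=
  match t, s, s' with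
  | Crossing, West, East | Crossing, South, North
  | Contact, West, North | Contact, South, East
  | Elbow, West, North => true
  | _, _, _ => false
  end.

(* The same unit edge, seen from the two cells on either side of it. *)
Definition glued m (u v : cell m * side) : bool :=
  match u.2, v.2 with
  | East, West => (row v.1 == row u.1) && (col v.1 == (col u.1).+1)
  | North, South => ((row v.1).+1 == row u.1) && (col v.1 == col u.1)
  | _, _ => false
  end.

Definition pipe_step m (P : pipe_dream m) : rel (cell m * side) :=
  fun u v => (u.1 == v.1) && strand (tile_at P u.1) u.2 v.2 || glued u v.

(* Pipes are indexed by the row in which they enter: the pipe p : 'I_m starts
   on the west side of the cell (p + 1, 1). *)
Definition on_pipe m (P : pipe_dream m) (p : 'I_m) (u : cell m * side) : bool :=
  [exists x : cell m,
     [&& row x == p.+1, col x == 1 & connect (pipe_step P) (x, West) u]].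

(* The two pipes in contact in a cell are the one coming in from the west and
   the one coming in from the south. *)
Definition is_bicoloring m (P : pipe_dream m) (k : {ffun 'I_m -> color}) :=
  [forall x, forall p, forall q,
     [&& tile_at P x == Contact, on_pipe P p (x, West)
       & on_pipe P q (x, South)] ==> (k p != k q)].

Definition bicolored_pipe_dream m :=
  {Pk : pipe_dream m * {ffun 'I_m -> color} | is_bicoloring Pk.1 Pk.2}.

(* Main.v *)
(* Read a depth triangle of order m + 2 as a height function on the corners of
   the cells of the staircase, vanishing on the antidiagonal, with increments
   of absolute value 1 along unit edges.  The increment across an edge is the
   color of the pipe through it (+1 red, -1 blue).  Going around a cell gives
   west + south = north + east, the rule of the six-vertex model: either the
   colors cross (west = east, south = north), or the two incoming colors differ
   and they bounce (west = north, south = east).  Contacts being two-colored,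
   exactly one of these tiles fits, so heights determine the tiles and the
   colors of the pipes; conversely tiles and colors determine the increments,
   column by column.  The catalan triangle gamma corresponds to the depth
   triangle 2 gamma - (2 y1 + y2 + 2). *)
Require Import Defs.
From mathcomp Require Import all_boot all_order all_algebra.
From mathcomp Require Import zify.

Set Implicit Arguments.
Unset Strict Implicit.
Unset Printing Implicit Defensive.

Import GRing.Theory Num.Theory.
Import Defs. (* otherwise [row] and [col] are those of matrices *)
Local Open Scope ring_scope.

(** * Coordinates on the triangle and on the staircase *)

Lemma triple_sum m (y : triple m.+2) : (y1 y + y2 y + y3 y = m)%N.
Proof. by have /eqP -> := valP y; rewrite !subSS subn0. Qed.

Lemma triple_inj m (y z : triple m.+2) : y1 y = y1 z -> y3 y = y3 z -> y = z.
Proof.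
move=> e1 e3; have e2 : y2 y = y2 z.
  by have := triple_sum y; have := triple_sum z; lia.
apply: val_inj; move: e1 e2 e3; rewrite /y1 /y2 /y3.
case: (val y) => [[a b] c]; case: (val z) => [[a' b'] c'] /= e1 e2 e3.
by congr (_, _, _); apply: val_inj.
Qed.

Lemma triple_ex m i j : (i + j <= m)%N ->
  exists y : triple m.+2, y1 y = j /\ y3 y = i.
Proof.
move=> ij.
have hj : (j < m.+1)%N by lia.
have hi : (i < m.+1)%N by lia.
have hk : (m - i - j < m.+1)%N by lia.
have e : (j + (m - i - j) + i == m.+2 - 2)%N by apply/eqP; lia.
by exists (exist (fun y : 'I_m.+1 * 'I_m.+1 * 'I_m.+1 =>
  (y.1.1 + y.1.2 + y.2 == m.+2 - 2)%N) (Ordinal hj, Ordinal hk, Ordinal hi) e).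
Qed.

Lemma cell_ex m r c : (0 < r)%N -> (0 < c)%N -> (r + c <= m.+1)%N ->
  exists x : cell m, row x = r /\ col x = c.
Proof.
move=> r0 c0 rc.
have hr : (r < m.+1)%N by lia.
have hc : (c < m.+1)%N by lia.
have e : [&& 0 < r, 0 < c & r + c <= m.+1]%N by apply/and3P.
by exists (exist (fun x : 'I_m.+1 * 'I_m.+1 =>
  [&& 0 < x.1, 0 < x.2 & x.1 + x.2 <= m.+1]%N) (Ordinal hr, Ordinal hc) e).
Qed.

Lemma cellP m (x : cell m) :
  [/\ (0 < row x)%N, (0 < col x)%N & (row x + col x <= m.+1)%N].
Proof. by have /and3P := valP x. Qed.

Lemma cell_inj m (x z : cell m) : row x = row z -> col x = col z -> x = z.
Proof.
move=> er ec; apply: val_inj; move: er ec; rewrite /row /col.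
case: (val x) => a b; case: (val z) => a' b' /= er ec.
by congr (_, _); apply: val_inj.
Qed.

Lemma tile_elbow m (P : pipe_dream m) x :
  (tile_at P x == Elbow) = (row x + col x == m.+1)%N.
Proof. by have /forallP/(_ x)/eqP := valP P. Qed.

Lemma tile_position m (P : pipe_dream m) x :
  match tile_at P x with
  | Elbow => (row x + col x = m.+1)%N
  | _ => is_true (row x + col x <= m)%N
  end.
Proof.
have [_ _] := cellP x; have := tile_elbow P x.
by case: (tile_at P x) => /esym; [move=> /negbT; lia|move=> /negbT; lia|move=> /eqP].
Qed.

(** * Colors as signs and depth triangles as height functions *)

Definition sgn_color (k : color) : int := if k is Red then 1 else -1.
Definition color_of_int (z : int) : color := if z == 1 then Red else Blue.

Lemma sgn_colorK : cancel sgn_color color_of_int. Proof. by case. Qed.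

Lemma color_of_intK z : `|z| = 1 -> sgn_color (color_of_int z) = z.
Proof. by move=> hz; rewrite /color_of_int; case: eqP => /= ?; lia. Qed.

Lemma color_of_intN z : `|z| = 1 -> color_of_int z != color_of_int (- z).
Proof.
by move=> hz; rewrite /color_of_int; case: (z =P 1); case: (- z =P 1) => //; lia.
Qed.

(* A depth triangle is read as heights on the corners of the cells: the point
   (i, j), i rows below and j columns right of the top left corner, is the
   triple (j, m - i - j, i). *)
Definition height_at m (delta : {ffun triple m.+2 -> int}) (i j : nat) : int :=
  if [pick y | (y1 y == j) && (y3 y == i)] is Some y then delta y else 0.

Lemma height_atE m (delta : {ffun triple m.+2 -> int}) y :
  height_at delta (y3 y) (y1 y) = delta y.
Proof.
rewrite /height_at; case: pickP => [z /andP[/eqP e1 /eqP e3]|/(_ y)].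
  by rewrite (triple_inj e1 e3).
by rewrite !eqxx.
Qed.

Definition is_height m (h : nat -> nat -> int) : Prop :=
  (forall i j, (i + j = m)%N -> h i j = 0) /\
  (forall i j, (i + j < m)%N ->
     `|h i j - h i.+1 j| = 1 /\ `|h i j - h i j.+1| = 1).

Lemma depth_heightP m (delta : {ffun triple m.+2 -> int}) :
  is_depth_triangle delta <-> is_height m (height_at delta).
Proof.
split=> [/and3P[/forallP h0 /forallP hl /forallP hr]|[h0 h1]].
  split=> i j ij.
    have [|y [ej ei]] := @triple_ex m i j; first lia.
    have s := triple_sum y; have /eqP y20 : y2 y = 0%N by lia.
    by rewrite -ei -ej height_atE; apply/eqP/(implyP (h0 y)).
  have [|y [ej ei]] := @triple_ex m i j; first lia.
  have [|z [zj zi]] := @triple_ex m i.+1 j; first lia.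
  have [|t [tj ti]] := @triple_ex m i j.+1; first lia.
  have s := triple_sum y; have sz := triple_sum z; have st := triple_sum t.
  have := height_atE delta t; have := height_atE delta z.
  have := height_atE delta y; rewrite ei ej zi zj ti tj => -> -> ->.
  split; apply/eqP.
    by apply: (implyP (forallP (hl y) z)); apply/and3P; split; apply/eqP; lia.
  by apply: (implyP (forallP (hr y) t)); apply/and3P; split; apply/eqP; lia.
apply/and3P; split.
- apply/forallP=> y; apply/implyP=> /eqP y20; rewrite -height_atE.
  by have s := triple_sum y; rewrite h0 //; lia.
- apply/forallP=> y; apply/forallP=> z; apply/implyP.
  move=> /and3P[/eqP e1 /eqP e2 /eqP e3]; rewrite -!height_atE e1 e3.
  by have s := triple_sum y; apply/eqP; have [] := h1 (y3 y) (y1 y); first lia.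
- apply/forallP=> y; apply/forallP=> z; apply/implyP.
  move=> /and3P[/eqP e1 /eqP e2 /eqP e3]; rewrite -!height_atE e1 e3.
  by have s := triple_sum y; apply/eqP; have [] := h1 (y3 y) (y1 y); first lia.
Qed.

Lemma height_at_ffun m (h : nat -> nat -> int) i j : (i + j <= m)%N ->
  height_at [ffun y : triple m.+2 => h (y3 y) (y1 y)] i j = h i j.
Proof.
by move=> /triple_ex[y [<- <-]]; rewrite height_atE ffunE.
Qed.

Lemma eq_is_height m (h h' : nat -> nat -> int) :
  (forall i j, (i + j <= m)%N -> h i j = h' i j) ->
  is_height m h -> is_height m h'.
Proof.
move=> eh [h0 h1]; split=> i j ij; first by rewrite -eh ?h0 //; lia.
by rewrite -!eh; [exact: h1|lia|lia|lia].
Qed.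

(** * Increments across edges and their constancy along pipes *)

(** In a boundary cell, [South] and [East] involve the corner [(r, c)] outside the triangle, where
    [is_height] says nothing. *)
Definition edge m (h : nat -> nat -> int) (u : cell m * side) : int :=
  let r := row u.1 in let c := col u.1 in
  match u.2 with
  | West => h r.-1 c.-1 - h r c.-1
  | South => h r c.-1 - h r c
  | East => h r.-1 c - h r c
  | North => h r.-1 c.-1 - h r.-1 c
  end.

(** Both sums telescope to the top left height minus the bottom right one. *)
Lemma edge_conservation m h (x : cell m) :
  edge h (x, West) + edge h (x, South) = edge h (x, North) + edge h (x, East).
Proof. by rewrite /edge /=; lia. Qed.

Lemma edge_unit m h (x : cell m) : is_height m h ->
  `|edge h (x, West)| = 1 /\ `|edge h (x, North)| = 1.
Proof.
move=> [_ h1]; have [] := cellP x; rewrite /edge /=.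
case: (row x) (col x) => [|r] [|c] //= _ _ rc.
by apply: h1; lia.
Qed.

Lemma edge_unit_inner m h (x : cell m) : is_height m h ->
  (row x + col x <= m)%N ->
  `|edge h (x, South)| = 1 /\ `|edge h (x, East)| = 1.
Proof.
move=> [_ h1]; have [] := cellP x; rewrite /edge /=.
case: (row x) (col x) => [|r] [|c] //= _ _ _ rc.
by split; [apply: (h1 _ _ _).2|apply: (h1 _ _ _).1]; lia.
Qed.

(** All four increments are units, so east is minus west; conservation then leaves a single
    possibility for north and south. *)
Lemma edge_contact m h (x : cell m) : is_height m h ->
  (row x + col x <= m)%N -> edge h (x, West) <> edge h (x, East) ->
  edge h (x, North) = edge h (x, West)
  /\ edge h (x, South) = - edge h (x, West).
Proof.
move=> hh rc; have [] := edge_unit x hh; have [] := edge_unit_inner hh rc.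
by have := edge_conservation h x; lia.
Qed.

(* In a crossing or a contact, the other strand follows by conservation. *)
Definition compatible m (P : pipe_dream m) (h : nat -> nat -> int) : Prop :=
  forall x, edge h (x, West)
    = edge h (x, if tile_at P x is Crossing then East else North).

(** Inside a tile, [compatible] handles the strand from the west and conservation the one from the
    south; glued sides are the same edge. *)
Lemma edge_step m (P : pipe_dream m) h u v :
  compatible P h -> pipe_step P u v -> edge h u = edge h v.
Proof.
case: u v => [x s] [z s'] cPh /orP[/andP[/eqP /= <-]|].
  move: (cPh x) (edge_conservation h x).
  by case: (tile_at P x) s s' => [] [] [] //; lia.
by rewrite /glued /edge; case: s s' => [] [] //= /andP[/eqP e /eqP e'];
  rewrite -?e ?e' //.
Qed.

Lemma edge_connect m (P : pipe_dream m) h u v :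
  compatible P h -> connect (pipe_step P) u v -> edge h u = edge h v.
Proof.
move=> cPh /connectP[q]; elim: q u => [u _ -> //|w q IH u /= /andP[uw wq] ev].
by rewrite (edge_step cPh uw); apply: IH.
Qed.

Lemma edge_on_pipe m (P : pipe_dream m) h (p : 'I_m) u :
  compatible P h -> on_pipe P p u -> edge h u = h p 0%N - h p.+1 0%N.
Proof.
move=> cPh /existsP[x /and3P[/eqP rx /eqP cx]] /(edge_connect cPh) <-.
by rewrite /edge /= rx cx.
Qed.

(** * Coverage of the cells by pipes *)

Definition on_some_pipe m (P : pipe_dream m) u := exists p, on_pipe P p u.

Lemma on_some_pipe_step m (P : pipe_dream m) u v :
  on_some_pipe P u -> pipe_step P u v -> on_some_pipe P v.
Proof.
move=> [p /existsP[x /and3P[rx cx xu]]] uv; exists p.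
apply/existsP; exists x; rewrite rx cx.
exact: connect_trans xu (connect1 uv).
Qed.

(* Pipes are followed backwards, to the left or downwards. *)
Lemma cell_on_pipe m (P : pipe_dream m) (x : cell m) :
  on_some_pipe P (x, West) /\
  ((row x + col x <= m)%N -> on_some_pipe P (x, South)).
Proof.
(* This measure drops by one on moving left or down. *)
have [d] := ubnP (col x + (m.+1 - row x))%N.
elim: d x => // d IH x hd; have [r0 c0 rc] := cellP x.
have strandN z s s' : on_some_pipe P (z, s) -> strand (tile_at P z) s s' ->
    on_some_pipe P (z, s').
  by move=> hz st; apply: (on_some_pipe_step hz); rewrite /pipe_step /= eqxx st.
split.
  have [c1|c1] := eqVneq (col x) 1%N.
    have rm : ((row x).-1 < m)%N by lia.
    exists (Ordinal rm); apply/existsP; exists x.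
    by rewrite /= c1 prednK // !eqxx connect0.
  have [|||z [rz cz]] := @cell_ex m (row x) (col x).-1; [lia|lia|lia|].
  have [|zW zS] := IH z; first by lia.
  have {}zS := zS ltac:(lia).
  apply: (@on_some_pipe_step _ _ (z, East)); last first.
    by rewrite /pipe_step /glued /= rz cz prednK // !eqxx orbT.
  have := tile_position P z; case E: (tile_at P z) => /=; last by lia.
    by move=> _; apply: strandN zW _; rewrite E.
  by move=> _; apply: strandN zS _; rewrite E.
move=> xm.
have [|||z [rz cz]] := @cell_ex m (row x).+1 (col x); [lia|lia|lia|].
have [|zW zS] := IH z; first by lia.
apply: (@on_some_pipe_step _ _ (z, North)); last first.
  by rewrite /pipe_step /glued /= rz cz !eqxx orbT.
(* The north side of the cell below is reached from its west in a contact or an elbow, from its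
   south in a crossing. *)
case E: (tile_at P z); last 2 first.
- by apply: strandN zW _; rewrite E.
- by apply: strandN zW _; rewrite E.
apply: (strandN _ South); last by rewrite E.
by apply: zS; have := cellP z; have := tile_position P z; rewrite E /=; lia.
Qed.

(** * From heights to bicolored pipe dreams *)

Definition tile_of_height m (h : nat -> nat -> int) (x : cell m) : tile :=
  if (row x + col x == m.+1)%N then Elbow
  else if edge h (x, West) == edge h (x, East) then Crossing else Contact.

Lemma tile_of_height_elbow m h :
  [forall x, ([ffun x : cell m => tile_of_height h x] x == Elbow)
     == (row x + col x == m.+1)%N].
Proof.
by apply/forallP=> x; rewrite ffunE /tile_of_height; case: ifP => // _; case: ifP.
Qed.

Definition dream_of_height m h : pipe_dream m :=
  exist (fun t : {ffun cell m -> tile} =>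
           [forall x, (t x == Elbow) == (row x + col x == m.+1)%N])
        _ (@tile_of_height_elbow m h).

Lemma tile_at_dream m h (x : cell m) :
  tile_at (dream_of_height m h) x = tile_of_height h x.
Proof. by rewrite /tile_at /= ffunE. Qed.

Lemma dream_compatible m h : is_height m h -> compatible (dream_of_height m h) h.
Proof.
move=> hh x; rewrite tile_at_dream /tile_of_height.
have [r0 c0 rc] := cellP x; case: eqP => [e|ne].
  (* In a boundary cell these two corners lie on the antidiagonal, so west and north increments both
     equal the top left height. *)
  have [h0 _] := hh; have := h0 (row x) (col x).-1; have := h0 (row x).-1 (col x).
  by rewrite /edge /=; lia.
case: eqP => [->|/edge_contact] //= WE.
by have [|->] := WE hh; first by lia.
Qed.

Definition coloring_of_height m (h : nat -> nat -> int) : {ffun 'I_m -> color} :=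
  [ffun p : 'I_m => color_of_int (h p 0%N - h p.+1 0%N)].

(** At a contact the west and south increments are opposite, and they give the colors of the two
    incoming pipes. *)
Lemma height_bicoloring m h : is_height m h ->
  is_bicoloring (dream_of_height m h) (coloring_of_height m h).
Proof.
move=> hh; apply/forallP=> x; apply/forallP=> p; apply/forallP=> q.
apply/implyP=> /and3P[]; rewrite tile_at_dream /tile_of_height.
case: ifP => // /negbT ne; case: ifP => // /negbT/eqP WE _.
have cP := dream_compatible hh.
move=> /(edge_on_pipe cP) eW /(edge_on_pipe cP) eS.
rewrite /coloring_of_height !ffunE -eW -eS.
have [_ _ rc] := cellP x; have [|_ ->] := edge_contact hh _ WE; first by lia.
by apply: color_of_intN; have [] := edge_unit x hh.
Qed.

(** * Uniqueness and existence of heights for given tiles and colors *)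

Lemma compatible_height_inj m (P : pipe_dream m) h h' :
  is_height m h -> is_height m h' -> compatible P h -> compatible P h' ->
  coloring_of_height m h = coloring_of_height m h' ->
  forall i j, (i + j <= m)%N -> h i j = h' i j.
Proof.
move=> [h0 h1] [h0' h1'] cP cP' ek i j; elim: j i => [|j IHj] i.
  (* Left border: the colors give the increments, summed upwards from the base point [(m, 0)]. *)
  rewrite addn0 => im; rewrite -(subKn im); move: (m - i)%N (leq_subr i m).
  elim=> [|d IHd] dm; first by rewrite subn0 h0 ?h0' ?addn0.
  have lt : (m - d.+1 < m)%N by lia.
  have := congr1 (fun f : {ffun 'I_m -> color} => sgn_color (f (Ordinal lt))) ek.
  rewrite /coloring_of_height !ffunE !color_of_intK /=; last first.
  - by apply: (h1 _ _ _).1; lia.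
  - by apply: (h1' _ _ _).1; lia.
  by rewrite subnSK // IHd 1?ltnW // => /addIr.
(* Next column, again upwards: the tile of the cell [(i+1, j+1)] gives its top right height from its
   other three corners. *)
move=> ij; have [d ed] : exists d, d = (m - j.+1 - i)%N by eexists.
elim: d i ij ed => [|d IHd] i ij ed; first by rewrite h0 ?h0' //; lia.
have [|||x [rx cx]] := @cell_ex m i.+1 j.+1; [lia|lia|lia|].
move: (cP x) (cP' x); rewrite /edge rx cx /=.
have := IHd i.+1; have := IHj i; have := IHj i.+1.
by case: (tile_at P x) => /=; lia.
Qed.

(** Extended to all pairs of numbers, with an arbitrary default, so that [column_height] can recurse
    on plain numbers. *)
Definition tile_at_nat m (P : pipe_dream m) (r c : nat) : tile :=
  if [pick x : cell m | (row x == r) && (col x == c)] is Some x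
  then tile_at P x else Elbow.

Lemma tile_at_natE m (P : pipe_dream m) x :
  tile_at_nat P (row x) (col x) = tile_at P x.
Proof.
rewrite /tile_at_nat; case: pickP => [z /andP[/eqP er /eqP ec]|/(_ x)].
  by rewrite (cell_inj er ec).
by rewrite !eqxx.
Qed.

(* The height at the point (m - d - j, j), i.e. in column j and d steps above
   the base of the triangle. *)
Fixpoint column_height m (t : nat -> nat -> tile) (s : nat -> int) (j : nat) :
    nat -> int :=
  fix col_height d :=
    if d isn't d'.+1 then 0 else
    if j isn't j'.+1 then col_height d' + s (m - d)%N else
    if t (m - d - j).+1 j is Crossing
    then col_height d' + column_height m t s j' d.+1 - column_height m t s j' d
    else column_height m t s j' d.

(** Each inner cell gives one equation, which [column_height] solves for the top right corner. *)
Lemma compatible_height_ex m (P : pipe_dream m) (k : {ffun 'I_m -> color}) :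
  exists h, [/\ compatible P h, forall i j, (i + j = m)%N -> h i j = 0
    & forall p : 'I_m, h p 0%N - h p.+1 0%N = sgn_color (k p)].
Proof.
pose s p := if insub p is Some q then sgn_color (k q) else 1.
pose h i j := column_height m (tile_at_nat P) s j (m - i - j).
have h0 i j : (i + j = m)%N -> h i j = 0.
  by move=> e; rewrite /h (_ : m - i - j = 0)%N; [case: j e|lia].
exists h; split=> // [x|p]; last first.
  have lt := ltn_ord p; rewrite /h (_ : m - p - 0 = (m - p.+1 - 0).+1)%N; last by lia.
  rewrite /= addrC addKr (_ : m - _ = p)%N; last by lia.
  by rewrite /s valK.
have := cellP x; have := tile_position P x; have := tile_at_natE P x.
rewrite /edge; case: (row x) (col x) => [|i] [|j] /= et ee [] // _ _ ij.
(* On the boundary the equation holds because both antidiagonal corners have height 0. *)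
have [e|ne] := eqVneq (i.+1 + j.+1)%N m.+1.
  move: ee; case: (tile_at P x) => /=; try lia; move=> _.
  by have := h0 i.+1 j; have := h0 i j.+1; lia.
have [d ed] : exists d, d.+1 = (m - i - j.+1)%N by exists (m - i - j.+1).-1; lia.
have hS : h i j.+1 = if tile_at P x is Crossing
    then h i.+1 j.+1 + h i j - h i.+1 j else h i.+1 j.
  rewrite /h -ed (_ : m - i.+1 - j.+1 = d)%N; last by lia.
  rewrite (_ : m - i - j = d.+2)%N; last by lia.
  rewrite (_ : m - i.+1 - j = d.+1)%N; last by lia.
  by rewrite /= (_ : m - d.+1 - j.+1 = i)%N ?et //; lia.
by case: (tile_at P x) hS => /=; lia.
Qed.

(** Unit increments spread from the left border, one column at a time. *)
Lemma compatible_is_height m (P : pipe_dream m) h :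
  compatible P h -> (forall i j, (i + j = m)%N -> h i j = 0) ->
  (forall p : 'I_m, `|h p 0%N - h p.+1 0%N| = 1) -> is_height m h.
Proof.
move=> cP h0 hk.
have step i j : (i + j < m)%N ->
    (i + j.+1 < m)%N /\ h i j - h i.+1 j = h i j.+1 - h i.+1 j.+1
    \/ h i j - h i.+1 j = h i j - h i j.+1.
  move=> ij; have [|||x [rx cx]] := @cell_ex m i.+1 j.+1; [lia|lia|lia|].
  have := cP x; have := tile_position P x; rewrite /edge rx cx /=.
  by case: (tile_at P x) => /= ? ?; [left; split=> //; lia|right|right].
(* A crossing passes the north increment of the cell below up to its own north side; any other tile
   copies its west increment. *)
have north j : (forall i, (i + j < m)%N -> `|h i j - h i.+1 j| = 1) ->
    forall i, (i + j < m)%N -> `|h i j - h i j.+1| = 1.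
  move=> west i ij; have [d] := ubnP (m - i)%N; elim: d i ij => // d IH i ij di.
  have w := west i ij; have [[ij' e]|<- //] := step i j ij.
  by have := IH i.+1; lia.
(* The east increment of a cell is its west one in a crossing, and otherwise its south one, the
   north increment of the cell below. *)
have west j : forall i, (i + j < m)%N -> `|h i j - h i.+1 j| = 1.
  elim: j => [|j IH] i ij; first by rewrite addn0 in ij; exact: (hk (Ordinal ij)).
  have ij' : (i + j < m)%N by lia.
  have := north j IH i.+1; have := IH i ij'.
  by have [[_ <-]|e] := step i j ij' => //; lia.
by split=> // i j ij; split; [exact: west|exact: (north j (west j))].
Qed.

(** If west equaled east at a contact of [P], conservation would equate west and south, giving two
    pipes in contact the same color. *)
Lemma compatible_dreamE m (P : pipe_dream m) (k : {ffun 'I_m -> color}) h :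
  is_bicoloring P k -> compatible P h -> is_height m h ->
  (forall p : 'I_m, h p 0%N - h p.+1 0%N = sgn_color (k p)) ->
  dream_of_height m h = P.
Proof.
move=> bic cP hh hk; apply: val_inj; apply/ffunP=> x.
rewrite -[RHS]/(tile_at P x) -[LHS]/(tile_at (dream_of_height m h) x).
rewrite tile_at_dream /tile_of_height -(tile_elbow P).
have := cP x; have := tile_position P x; have := edge_conservation h x.
case E: (tile_at P x) => //= cons el WE; first by rewrite WE eqxx.
have [r0 c0 rc] := cellP x; have [[p hp] hS] := cell_on_pipe P x.
have [|q hq] := hS; first by lia.
have := implyP (forallP (forallP (forallP bic x) p) q).
rewrite E hp hq => /(_ isT) kpq; case: eqP => // WE'; case/eqP: kpq.
have eW := edge_on_pipe cP hp; have eS := edge_on_pipe cP hq.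
apply: (can_inj sgn_colorK); rewrite -!hk -eW -eS WE'.
by move: cons; rewrite -WE => /addrI ->.
Qed.

(** * The bijection from depth triangles *)

Definition bicolored_of_depth m (delta : depth_triangle m.+2) :
    bicolored_pipe_dream m :=
  exist (fun Pk : pipe_dream m * {ffun 'I_m -> color} => is_bicoloring Pk.1 Pk.2)
    (dream_of_height m (height_at (val delta)),
     coloring_of_height m (height_at (val delta)))
    (height_bicoloring ((depth_heightP (val delta)).1 (valP delta))).

Lemma bicolored_of_depth_inj m : injective (@bicolored_of_depth m).
Proof.
move=> d d' e.
have eP : dream_of_height m (height_at (val d)) =
    dream_of_height m (height_at (val d')) := congr1 (fun z => (val z).1) e.
have ek : coloring_of_height m (height_at (val d)) =
    coloring_of_height m (height_at (val d')) := congr1 (fun z => (val z).2) e.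
have hh := (depth_heightP (val d)).1 (valP d).
have hh' := (depth_heightP (val d')).1 (valP d').
have cP := dream_compatible hh; have cP' := dream_compatible hh'.
rewrite eP in cP; have eh := compatible_height_inj hh hh' cP cP' ek.
apply: val_inj; apply/ffunP=> y; rewrite -!height_atE.
by apply: eh => //; have := triple_sum y; lia.
Qed.

Lemma bicolored_of_depth_surj m (Pk : bicolored_pipe_dream m) :
  exists d, bicolored_of_depth d = Pk.
Proof.
case: Pk => [[P k] /= bic]; have [h [cP h0 hk]] := compatible_height_ex P k.
have hh : is_height m h.
  by apply: (compatible_is_height cP h0) => p; rewrite hk; case: (k p).
pose delta := [ffun y : triple m.+2 => h (y3 y) (y1 y)].
have eh i j : (i + j <= m)%N -> h i j = height_at delta i j.
  by move=> ij; rewrite height_at_ffun.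
have hd := eq_is_height eh hh.
have cd : compatible P (height_at delta).
  (* The equation of [x] only reads corners inside the triangle: [(r, c)] occurs just for a
     crossing, which is off the boundary. *)
  move=> x; have := cP x; have [r0 c0 rc] := cellP x.
  have := tile_position P x; rewrite /edge.
  by case: (tile_at P x) => /= el; rewrite -?eh //; lia.
have hkd (p : 'I_m) :
    height_at delta p 0%N - height_at delta p.+1 0%N = sgn_color (k p).
  by have lt := ltn_ord p; rewrite -!eh ?hk // addn0 // ltnW.
exists (exist (fun d : {ffun triple m.+2 -> int} => is_depth_triangle d)
  delta ((depth_heightP delta).2 hd)).
apply: val_inj => /=; congr (_, _).
  exact: compatible_dreamE bic cd hd hkd.
by apply/ffunP=> p; rewrite ffunE hkd sgn_colorK.
Qed.

Lemma inj_surj_bij (A : choiceType) (B : eqType) (f : A -> B) :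
  injective f -> (forall b, exists a, f a = b) -> bijective f.
Proof.
move=> fi fs; have fs' b : exists a, f a == b by have [a <-] := fs b; exists a.
have fK b : f (xchoose (fs' b)) = b by apply/eqP; exact: xchooseP (fs' b).
by exists (fun b => xchoose (fs' b)) => // a; apply: fi.
Qed.

(** * Catalan triangles as depth triangles *)

Definition depth_fun_of_catalan m (gamma : {ffun triple m.+2 -> nat}) :
    {ffun triple m.+2 -> int} :=
  [ffun y => ((gamma y).*2)%:Z - ((y1 y).*2 + y2 y + 2)%N%:Z].

(** The subtracted term drops by 1 along [nextl] and grows by 1 along [nextr], so increments 0 or 1
    of [gamma] become signs. *)
Lemma catalan_depth m (gamma : {ffun triple m.+2 -> nat}) :
  is_catalan_triangle gamma = is_depth_triangle (depth_fun_of_catalan gamma).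
Proof.
congr [&& _, _ & _]; apply: eq_forallb => y; last 2 first.
- apply: eq_forallb => z; rewrite !ffunE.
  by case: (boolP (nextl y z)) => //= /and3P[/eqP e1 /eqP e2 /eqP e3]; lia.
- apply: eq_forallb => z; rewrite !ffunE.
  by case: (boolP (nextr y z)) => //= /and3P[/eqP e1 /eqP e2 /eqP e3]; lia.
by rewrite ffunE; case: eqP => //= e; lia.
Qed.

Lemma nextl_ex m (y : triple m.+2) : (0 < y2 y)%N -> exists z, nextl y z.
Proof.
move=> y20; have s := triple_sum y.
have [|z [z1 z3]] := @triple_ex m (y3 y).+1 (y1 y); first by lia.
have sz := triple_sum z.
by exists z; apply/and3P; split; apply/eqP; lia.
Qed.

(** Starting from [y1 + 1] where [y2] is 0 and undoing [nextl] steps, [g] grows by 0 or 1 each time,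
    so it remains a natural number. *)
Lemma depth_parity m (delta : {ffun triple m.+2 -> int}) :
  is_depth_triangle delta -> forall y,
  exists g : nat, (g.*2)%:Z - ((y1 y).*2 + y2 y + 2)%N%:Z = delta y.
Proof.
move=> /and3P[/forallP h0 /forallP hl _].
move=> y; have [d] := ubnP (y2 y); elim: d y => // d IH y yd.
have [y20|] := posnP (y2 y).
  by have := h0 y; rewrite y20 => /eqP ->; exists (y1 y).+1; lia.
move=> /nextl_ex[z yz]; have /eqP := implyP (forallP (hl y) z) yz.
case/and3P: yz => /eqP e1 /eqP e2 /eqP e3.
have [|g <-] := IH z; first by lia.
move=> hy; have [up|down] : delta y = g.*2%:Z - ((y1 z).*2 + y2 z + 2)%N%:Z + 1
    \/ delta y = g.*2%:Z - ((y1 z).*2 + y2 z + 2)%N%:Z - 1 by lia.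
  by exists g.+1; lia.
by exists g; lia.
Qed.

Definition depth_of_catalan m (gamma : catalan_triangle m.+2) :
    depth_triangle m.+2 :=
  exist (fun d : {ffun triple m.+2 -> int} => is_depth_triangle d)
    (depth_fun_of_catalan (val gamma))
    (etrans (esym (catalan_depth (val gamma))) (valP gamma)).

Lemma depth_of_catalan_inj m : injective (@depth_of_catalan m).
Proof.
move=> g g' gg'; apply: val_inj; apply/ffunP=> y.
have e : depth_fun_of_catalan (val g) = depth_fun_of_catalan (val g') :=
  congr1 val gg'.
have := congr1 (fun f : {ffun triple m.+2 -> int} => f y) e.
by rewrite !ffunE => /addIr[/double_inj].
Qed.

Lemma depth_of_catalan_surj m (d : depth_triangle m.+2) :
  exists g, depth_of_catalan g = d.
Proof.
have ex y : exists g : nat,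
    (g.*2)%:Z - ((y1 y).*2 + y2 y + 2)%N%:Z == val d y.
  by have [g e] := depth_parity (valP d) y; exists g; apply/eqP.
pose gamma := [ffun y => xchoose (ex y)].
have e : depth_fun_of_catalan gamma = val d.
  by apply/ffunP=> y; rewrite !ffunE; apply/eqP/(xchooseP (ex y)).
have cg : is_catalan_triangle gamma by rewrite catalan_depth e (valP d).
exists (exist (fun g : {ffun triple m.+2 -> nat} => is_catalan_triangle g)
  gamma cg).
exact: val_inj.
Qed.

Local Close Scope ring_scope.

Theorem proposition4p18 (n : nat) (hn : 2 <= n) :
  (exists f : depth_triangle n -> bicolored_pipe_dream (n - 2), bijective f) /\
  (exists g : catalan_triangle n -> bicolored_pipe_dream (n - 2), bijective g).
Proof.
case: n hn => [|[|m]] // _; rewrite !subSS subn0.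
have bij := inj_surj_bij (@bicolored_of_depth_inj m)
  (@bicolored_of_depth_surj m).
have bij' := inj_surj_bij (@depth_of_catalan_inj m) (@depth_of_catalan_surj m).
split; first by exists (@bicolored_of_depth m).
by exists (@bicolored_of_depth m \o @depth_of_catalan m); apply: bij_comp.
Qed.
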